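(* Let $G$ be a maximally edge-connected graph of order $m\geq 5$ with $\delta(G)\geq 2$, and let $n\geq 4$. Then $$\lambda_3(G\boxtimes C_n)=\xi_3(G\boxtimes C_n)=\begin{cases}9\delta(G), & \text{if } \xi(G)=2\delta(G)-2;\\ 9\delta(G)+2, & \text{otherwise.}\end{cases}$$ That is, $G\boxtimes C_n$ is maximally 3-restricted edge-connected.
   Context: Graphs are finite and simple. The order of $G$ is $|V(G)|$; $d_G(u)$ is the degree of $u$, and $\delta(G)$ is the minimum degree of $G$. $C_n$ is the cycle of order $n$. An edge subset $S\subseteq E(G)$ is an edge-cut if $G-S$ is disconnected; the edge-connectivity $\lambda(G)$ is the minimum cardinality of an edge-cut. $G$ is maximally edge-connected if $\lambda(G)=\delta(G)$. For an edge $e=uv\in E(G)$, its edge-degree is $\xi_G(e)=d_G(u)+d_G(v)-2$, and $\xi(G)=\min\{\xi_G(e) : e\in E(G)\}$. An edge subset $S\subseteq E(G)$ is a 3-restricted edge-cut if $G-S$ is disconnected and each component of $G-S$ has at least three vertices. $\lambda_3(G)$ is the minimum cardinality of a 3-restricted edge-cut of $G$ if one exists, and $\lambda_3(G)=+\infty$ otherwise. For $X\subseteq V(G)$, $\partial_G(X)$ is the set of edges with one endpoint in $X$ and the other in $V(G)\setminus X$, and $\xi_3(G)=\min\{|\partial_G(X)| : X\subseteq V(G),\ |X|=3,\ G[X]\text{ is connected}\}$. $G$ is maximally 3-restricted edge-connected if $\lambda_3(G)=\xi_3(G)$. The strong product $G\boxtimes H$ has vertex set $V(G)\times V(H)$;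 two distinct vertices $(x_1,y_1)$, $(x_2,y_2)$ are adjacent iff $x_1=x_2$ and $y_1y_2\in E(H)$, or $y_1=y_2$ and $x_1x_2\in E(G)$, or $x_1x_2\in E(G)$ and $y_1y_2\in E(H)$. *)

(* Defs.v *)
(* MathComp *)
From mathcomp Require Import all_boot.
Set Implicit Arguments.
Unset Strict Implicit.
Unset Printing Implicit Defensive.

Record sgraph := SGraph {
  vertex :> finType;
  adj : rel vertex;
  adj_sym : symmetric adj;
  adj_irr : irreflexive adj }.

(* Minimum of F over the i satisfying P; None stands for +oo, the minimum of
   the empty family. *)
Definition minval (I : finType) (P : pred I) (F : I -> nat) : option nat :=
  if [pick i | P i] is Some i0 then Some (F [arg min_(i < i0 | P i) F i])
  else None.

Section Invariants.
Variable G : sgraph.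

(* An edge is the two-element set of its endpoints. *)
Definition edges : {set {set G}} :=
  [set e | [exists x, exists y, adj x y && (e == [set x; y])]].

Definition degree (x : G) : nat := #|[set y | adj x y]|.

(* The value 0 for the graph without vertices is a dummy. *)
Definition min_degree : nat := odflt 0 (minval xpredT degree).

Definition connected : bool := [forall x : G, forall y : G, connect (@adj G) x y].

Definition components : {set {set G}} :=
  [set [set y | connect (@adj G) x y] | x : G].

Lemma del_edges_sym (S : {set {set G}}) :
  symmetric (fun x y : G => adj x y && ([set x; y] \notin S)).
Proof. by move=> x y; rewrite adj_sym setUC. Qed.

Lemma del_edges_irr (S : {set {set G}}) :
  irreflexive (fun x y : G => adj x y && ([set x; y] \notin S)).
Proof. by move=> x; rewrite adj_irr. Qed.

Definition del_edges (S : {set {set G}}) : sgraph :=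
  SGraph (del_edges_sym S) (del_edges_irr S).

Lemma induced_sym (X : {set G}) :
  symmetric (fun u v : {x : G | x \in X} => adj (val u) (val v)).
Proof. by move=> u v; apply: adj_sym. Qed.

Lemma induced_irr (X : {set G}) :
  irreflexive (fun u v : {x : G | x \in X} => adj (val u) (val v)).
Proof. by move=> u; apply: adj_irr. Qed.

Definition induced (X : {set G}) : sgraph :=
  SGraph (@induced_sym X) (@induced_irr X).

End Invariants.

Definition edge_cut (G : sgraph) (S : {set {set G}}) : bool :=
  (S \subset edges G) && ~~ connected (del_edges S).

Definition edge_connectivity (G : sgraph) : option nat :=
  minval (@edge_cut G) (fun S => #|S|).

Definition maximally_edge_connected (G : sgraph) : Prop :=
  edge_connectivity G = Some (min_degree G).

(* For e = [set u; v] with u != v, the sum is degree u + degree v. *)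
Definition edge_degree (G : sgraph) (e : {set G}) : nat :=
  \sum_(x in e) degree x - 2.

Definition min_edge_degree (G : sgraph) : option nat :=
  minval (mem (edges G)) (@edge_degree G).

Definition restricted3_edge_cut (G : sgraph) (S : {set {set G}}) : bool :=
  edge_cut S && [forall C in components (del_edges S), 3 <= #|C|].

Definition lambda3 (G : sgraph) : option nat :=
  minval (@restricted3_edge_cut G) (fun S => #|S|).

Definition boundary (G : sgraph) (X : {set G}) : {set {set G}} :=
  [set e in edges G | [exists x in X, exists y in ~: X, e == [set x; y]]].

Definition xi3 (G : sgraph) : option nat :=
  minval (fun X : {set G} => (#|X| == 3) && connected (induced X))
         (fun X => #|boundary X|).

Definition maximally_3restricted_edge_connected (G : sgraph) : Prop :=
  lambda3 G = xi3 G.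

Section StrongProduct.
Variables G H : sgraph.

Definition strong_adj : rel (G * H) := fun p q =>
  (p != q) && [|| (p.1 == q.1) && adj p.2 q.2,
                  (p.2 == q.2) && adj p.1 q.1
                | adj p.1 q.1 && adj p.2 q.2].

Lemma strong_adj_sym : symmetric strong_adj.
Proof.
move=> p q; rewrite /strong_adj (eq_sym p) (eq_sym p.1) (eq_sym p.2).
by rewrite (adj_sym p.1) (adj_sym p.2).
Qed.

Lemma strong_adj_irr : irreflexive strong_adj.
Proof. by move=> p; rewrite /strong_adj eqxx. Qed.

Definition strong_product : sgraph := SGraph strong_adj_sym strong_adj_irr.

End StrongProduct.

Section Cycle.
Variable n : nat.

(* ordS i is i + 1 modulo n; this is the cycle of order n when n >= 3. *)
Definition cycle_adj : rel 'I_n := fun i j =>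
  (i != j) && ((ordS i == j) || (ordS j == i)).

Lemma cycle_adj_sym : symmetric cycle_adj.
Proof. by move=> i j; rewrite /cycle_adj eq_sym orbC. Qed.

Lemma cycle_adj_irr : irreflexive cycle_adj.
Proof. by move=> i; rewrite /cycle_adj eqxx. Qed.

Definition cycle_graph : sgraph := SGraph cycle_adj_sym cycle_adj_irr.

End Cycle.

(* Main.v *)
(* For an edge set separating A from its complement, look at the layers A_y of A
   over the vertices y of the cycle. A layer that is neither empty nor full has at
   least delta boundary edges inside its copy of G, because lambda(G) = delta. Two
   consecutive such layers are joined by at least 2 delta cut edges, and such a
   layer next to an empty or full one is joined to it by at least delta + 1. Hence
   k such layers cost at least 3 k delta, plus 2 if they do not fill the cycle,
   which suffices when k >= 3 and no layer is full. Moreover the cut edges between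
   consecutive layers dominate the change of the degree sum
   sum_(x in A_y) (d(x) + 1), so going from a layer u to a layer v both ways round
   the cycle costs twice the difference; this settles a full layer together with
   an empty one, and a layer with at least three vertices. Passing to the
   complement of A, only |A| = 3 and |A| = 4 are left, where counting degrees is
   enough; |A| = 3 gives xi_3, attained at a triangle over an edge whose ends both
   have degree delta, or else at a path over a single vertex of degree delta. *)
Require Import Defs.
From mathcomp Require Import all_boot zify.
Set Implicit Arguments.
Unset Strict Implicit.
Unset Printing Implicit Defensive.

(** * Minima over finite families, and edges as two-element sets *)

Section Minval.
Variables (I : finType) (P : pred I) (F : I -> nat).

Lemma minvalP k : minval P F = Some k ->
  (exists2 i, P i & F i = k) /\ (forall i, P i -> k <= F i).
Proof.
rewrite /minval; case: pickP => // i0 Pi0 [<-].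
by case: arg_minnP => // i Pi Fmin; split=> //; exists i.
Qed.

Lemma minval_eq k i :
  P i -> F i <= k -> (forall j, P j -> k <= F j) -> minval P F = Some k.
Proof.
move=> Pi Fik kF; rewrite /minval; case: pickP => [i0 Pi0|/(_ i)]; last first.
  by rewrite Pi.
case: arg_minnP => // j Pj Fmin; congr Some; apply/eqP.
by rewrite eqn_leq kF // andbT (leq_trans (Fmin _ Pi)).
Qed.

End Minval.

Lemma edgesP (G : sgraph) (e : {set G}) :
  reflect (exists x y, adj x y /\ e = [set x; y]) (e \in edges G).
Proof.
rewrite inE; apply: (iffP existsP) => [[x /existsP[y /andP[xy /eqP->]]]|].
  by exists x, y.
by case=> x [y [xy ->]]; exists x; apply/existsP; exists y; rewrite xy /=.
Qed.

(** * Counting linked pairs of vertices in a graph *)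

Section Links.
Variable G : sgraph.
Implicit Types (x y : G) (a b : {set G}).

(** Closed adjacency: in a strong product it is the conjunction of the closed adjacencies of the two
    factors. *)
Definition cadj x y := (x == y) || adj x y.

Lemma cadj_sym x y : cadj x y = cadj y x.
Proof. by rewrite /cadj eq_sym adj_sym. Qed.

(* Ordered pairs, each vertex counting as linked to itself: thus [links a setT] is
   the sum of [degree x + 1] over a, and [links a (~: b) + links b (~: a)] counts
   the cut edges between consecutive layers a and b of the strong product. *)
Definition links a b := \sum_(x in a) \sum_(y in b) (cadj x y : nat).

Lemma linksE a b : links a b =
  \sum_x \sum_y (if (x \in a) && (y \in b) then cadj x y : nat else 0).
Proof.
rewrite /links big_mkcond; apply: eq_bigr => x _ /=.
case: (x \in a) => /=; last by rewrite big1.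
by rewrite big_mkcond.
Qed.

Lemma links_sym a b : links a b = links b a.
Proof.
rewrite /links exchange_big; apply: eq_bigr => x _; apply: eq_bigr => y _.
by rewrite cadj_sym.
Qed.

Lemma links_setC a b : links a b + links a (~: b) = links a setT.
Proof.
rewrite /links -big_split; apply: eq_bigr => x _ /=.
rewrite [RHS](bigID (mem b)) /=; congr (_ + _); apply: eq_bigl => y;
  by rewrite !inE.
Qed.

Lemma links_leT a b : links a b <= links a setT.
Proof. by rewrite -(links_setC a b) leq_addr. Qed.

Lemma links_le_card a b : links a b <= #|a| * #|b|.
Proof.
rewrite /links -sum_nat_const; apply: leq_sum => x _.
by rewrite -sum1_card; apply: leq_sum => y _; case: cadj.
Qed.

(** The ordered pairs [(x, y)] and [(y, x)] are both missing from the [#|a| * #|a|] possible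
    ones. *)
Lemma links_nonadj a x y : x \in a -> y \in a -> ~~ cadj x y ->
  links a a + 2 <= #|a| * #|a|.
Proof.
move=> xa ya xy; have yx : ~~ cadj y x by rewrite cadj_sym.
have nxy : y != x by apply: contraNneq xy => ->; rewrite /cadj eqxx.
have row z : \sum_(t in a) (cadj z t : nat) <= #|a|.
  by rewrite -sum1_card leq_sum // => t _; case: cadj.
have row' z t : t \in a -> ~~ cadj z t -> \sum_(t in a) (cadj z t : nat) < #|a|.
  move=> ta zt; rewrite -sum1_card (bigD1 t) // [X in _ < X](bigD1 t) //=.
  by rewrite (negPf zt) add0n add1n ltnS leq_sum // => u _; case: cadj.
rewrite -sum_nat_const /links (bigD1 x) //=.
rewrite [X in _ + X + 2](bigD1 y) /= ?ya //.
rewrite [leqRHS](bigD1 x) //= [X in _ <= _ + X](bigD1 y) /= ?ya //.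
have := row' _ _ ya xy; have := row' _ _ xa yx.
have : \sum_(z | (z \in a) && (z != x) && (z != y)) \sum_(t in a) cadj z t <=
    \sum_(z | (z \in a) && (z != x) && (z != y)) #|a|.
  by apply: leq_sum => z _; apply: row.
by lia.
Qed.

Lemma links0l a : links set0 a = 0.
Proof. by rewrite /links big_set0. Qed.

Lemma cadj_degree x : \sum_y (cadj x y : nat) = (degree x).+1.
Proof.
rewrite (bigD1 x) //= /cadj eqxx /= add1n; congr _.+1.
rewrite /degree -sum1_card [RHS]big_mkcond [LHS]big_mkcond /=.
apply: eq_bigr => y _; rewrite !inE /= eq_sym.
by have [->|_] := eqVneq x y; rewrite ?adj_irr //=; case: adj.
Qed.

Lemma linksT a : links a setT = \sum_(x in a) (degree x).+1.
Proof.
apply: eq_bigr => x _; rewrite -cadj_degree.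
by apply: eq_bigl => y; rewrite inE.
Qed.

Lemma card_boundary a : #|boundary a| = links a (~: a).
Proof.
pose E := [set p : G * G | [&& p.1 \in a, p.2 \in ~: a & adj p.1 p.2]].
have -> : boundary a = [set [set p.1; p.2] | p in E].
  apply/setP => e; apply/setIdP/imsetP.
    case=> /edgesP[u [v [uv ->]]] /exists_inP[x xa /exists_inP[y ya /eqP exy]].
    exists (x, y); rewrite ?inE //= xa; move: (ya); rewrite inE => -> /=.
    have xuv : x \in [set u; v] by rewrite exy !inE eqxx.
    have yuv : y \in [set u; v] by rewrite exy !inE eqxx orbT.
    have nxy : x != y by apply: contraTneq xa => ->; rewrite inE in ya.
    move: xuv yuv nxy; rewrite !inE => /orP[]/eqP-> /orP[]/eqP->;
      by rewrite ?eqxx // adj_sym.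
  case=> -[x y]; rewrite inE /= => /and3P[xa ya xy] ->; split.
    by apply/edgesP; exists x, y.
  by apply/exists_inP; exists x => //; apply/exists_inP; exists y.
rewrite card_in_imset; last first.
  move=> [x y] [u v]; rewrite !inE /= => /and3P[xa ya _] /and3P[ua va _] e.
  have xuv : x \in [set u; v] by rewrite -e !inE eqxx.
  have yuv : y \in [set u; v] by rewrite -e !inE eqxx orbT.
  move: xuv yuv xa ya ua va; rewrite !inE => /orP[]/eqP-> /orP[]/eqP-> //;
    by [move=> -> | move=> _ /negPf->].
rewrite /links pair_big_dep /= -sum1_card.
rewrite [RHS]big_mkcond [LHS]big_mkcond /=; apply: eq_bigr => -[x y] _.
rewrite !inE /=; case xa: (x \in a) => //=; case ya: (y \in a) => //=.
rewrite /cadj; case: eqVneq => [xy|_] /=; last by case: adj.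
by rewrite -xy xa in ya.
Qed.

Lemma links_setCC a b : links (~: a) (~: ~: b) = links b (~: a).
Proof. by rewrite setCK links_sym. Qed.

(** The links of [a] that do not leave [b] are, by symmetry, also links of [b]. *)
Lemma linksT_step a b : links a setT <= links b setT + links a (~: b).
Proof. by have := links_leT b a; have := links_setC a b; rewrite (links_sym b); lia. Qed.

Variable d : nat.
Hypothesis deg_d : forall x, d <= degree x.

Lemma linksT_ge a : #|a| * d.+1 <= links a setT.
Proof. by rewrite linksT -sum_nat_const leq_sum // => x _; rewrite ltnS. Qed.

(** A vertex of [a] lies outside [b], which gives the 1 through its link to itself; moreover at most
    [#|b|] of its at least [d.+1] links end in [b]. *)
Lemma links_ge_disjoint a b :
  a :&: b = set0 -> #|a| * maxn 1 (d.+1 - #|b|) <= links a (~: b).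
Proof.
move=> ab0; rewrite -sum_nat_const leq_sum // => x xa.
have /negbT xb : (x \in b) = false by rewrite -(in_set0 x) -ab0 inE xa.
rewrite geq_max; apply/andP; split.
  by rewrite (bigD1 x) /= ?inE // /cadj eqxx.
have := links_setC [set x] b; have := links_le_card [set x] b.
have := linksT_ge [set x].
have -> : \sum_(y in ~: b) (cadj x y : nat) = links [set x] (~: b).
  by rewrite /links big_set1.
by rewrite cards1; lia.
Qed.

Lemma cross_disjoint a b : 0 < d -> a != set0 -> b != set0 ->
  a :&: b = set0 -> 2 * d <= links a (~: b) + links b (~: a).
Proof.
rewrite -!card_gt0 => d0 a0 b0 ab0.
have := links_ge_disjoint ab0; rewrite setIC in ab0.
have := links_ge_disjoint ab0.
move: (links _ _) (links _ _) => k l.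
move: #|a| #|b| a0 b0 => s t s0 t0 h1 h2.
suff: 2 * d <= t * maxn 1 (d.+1 - s) + s * maxn 1 (d.+1 - t) by lia.
(* Since [s] and [t] are positive, the two products are at least [t + (d - s)] and [s + (d - t)],
   and [s + (d - s) >= d] even when the subtraction truncates. *)
have maxE m : maxn 1 (d.+1 - m) = (d - m).+1 by lia.
have := leq_mul t0 (leqnn (d - s)); have := leq_mul s0 (leqnn (d - t)).
by rewrite !maxE !mul1n !mulnS; lia.
Qed.

Hypothesis cut_d : forall a, a != set0 -> a != setT -> d <= links a (~: a).

(* If both a :&: b and ~: (a :|: b) are nonempty, the links across contain a cut
   around each of the two; otherwise a and b, or their complements, are
   disjoint. *)
Lemma cross_ge a b : 0 < d -> a != set0 -> b != set0 -> a != setT ->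
  b != setT -> 2 * d <= links a (~: b) + links b (~: a).
Proof.
move=> d0 a0 b0 aT bT; have [c0|c0] := eqVneq (a :&: b) set0.
  exact: cross_disjoint.
have nT c : c != setT -> ~: c != set0.
  by apply: contraNneq => c0'; rewrite -(setCK c) c0' setC0.
have [r0|r0] := eqVneq (~: a :&: ~: b) set0.
  rewrite addnC -(links_setCC a b) -(links_setCC b a).
  by apply: cross_disjoint => //; apply: nT.
set c := a :&: b in c0; set r := _ :&: _ in r0.
have cT : c != setT by apply: contraNneq aT => cT; rewrite -subTset -cT subsetIl.
have rT : r != setT.
  apply: contraNneq a0 => rT; rewrite -[a]setCK -setCT; apply/eqP.
  by congr (~: _); apply/eqP; rewrite -subTset -rT subsetIl.
have := cut_d c0 cT; have := cut_d r0 rT.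
(* Both orders of every pair are counted, so that the inequality holds for each ordered pair
   separately, according to the membership of its ends in [a] and [b]. *)
suff: links c (~: c) + links (~: c) c + (links r (~: r) + links (~: r) r) <=
   links a (~: b) + links (~: b) a + (links b (~: a) + links (~: a) b).
  rewrite (links_sym (~: c)) (links_sym (~: r)) (links_sym (~: a)).
  by rewrite (links_sym (~: b)); lia.
rewrite !linksE -!big_split leq_sum // => x _; rewrite -!big_split leq_sum // => y _.
rewrite /= !inE; case: (x \in a); case: (x \in b);
by case: (y \in a); case: (y \in b); case: cadj.
Qed.

End Links.

(** * Walking round a cycle, and neighbourhoods in it *)

Section Cycle.
Variable n : nat.

Lemma val_iter_ordS (u : 'I_n) j : iter j (@ordS n) u = (u + j) %% n :> nat.
Proof.
elim: j => [|j IH]; first by rewrite addn0 modn_small.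
by rewrite iterS /= IH -addn1 modnDml addn1 addnS.
Qed.

Lemma sum_iter_ordS (u : 'I_n) (k : 'I_n -> nat) :
  \sum_(i < n) k (iter i (@ordS n) u) = \sum_y k y.
Proof.
rewrite [RHS](reindex_inj (h := fun i : 'I_n => iter i (@ordS n) u)) //.
move=> i j /(congr1 val); rewrite /= !val_iter_ordS => /eqP.
by rewrite eqn_modDl !modn_small // => /eqP/val_inj.
Qed.

(** Walking forward from [u] reaches [v] in fewer than [n] steps, so each cost [k y] is paid at most
    once. *)
Lemma cycle_descent (f k : 'I_n -> nat) (u v : 'I_n) :
  (forall y, f y <= f (ordS y) + k y) -> f u <= f v + \sum_y k y.
Proof.
move=> fk.
have step j : f u <= f (iter j (@ordS n) u) + \sum_(i < j) k (iter i (@ordS n) u).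
  elim: j => [|j IH]; first by rewrite big_ord0 addn0.
  rewrite big_ord_recr /=; apply: leq_trans IH _.
  by rewrite addnCA [leqLHS]addnC leq_add2l fk.
pose j := (v + (n - u)) %% n.
have jn : j < n by rewrite ltn_mod (leq_ltn_trans _ (ltn_ord u)).
have jv : iter j (@ordS n) u = v.
  apply: val_inj; rewrite /= val_iter_ordS modnDmr addnCA subnKC; last exact: ltnW.
  by rewrite modnDr modn_small.
rewrite -(sum_iter_ordS u k).
have := step j; rewrite jv => /leq_trans; apply; rewrite leq_add2l.
rewrite -!(big_mkord xpredT (fun i => k (iter i (@ordS n) u))).
by rewrite [leqRHS](big_cat_nat (n := j)) ?leq_addr // ltnW.
Qed.

(** Replacing [f] by [M - f], with [M] an upper bound of [f], turns this into the descent from [v]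
    to [u]. *)
Lemma cycle_ascent (f k : 'I_n -> nat) (u v : 'I_n) :
  (forall y, f (ordS y) <= f y + k y) -> f u <= f v + \sum_y k y.
Proof.
move=> fk; pose M := \sum_y f y.
have fM y : f y <= M by rewrite /M (bigD1 y) //= leq_addr.
have := @cycle_descent (fun y => M - f y) k v u.
have := fM u; have := fM v => fv fu H; suff /H : forall y, M - f y <= M - f (ordS y) + k y.
  by lia.
by move=> y; have := fk y; have := fM (ordS y); have := fM y; lia.
Qed.

Lemma cadj_cycleE (y z : 'I_n) : @cadj (cycle_graph n) y z =
  [|| z == y, z == ordS y | y == ordS z].
Proof.
rewrite /cadj /= /cycle_adj eq_sym; case: eqVneq => //= _.
by rewrite (eq_sym z) (eq_sym y).
Qed.

(** It follows that three distinct, pairwise linked vertices of the product cannot all lie over one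
    vertex of [G]. *)
Lemma cycle_triangle_free (y1 y2 y3 : 'I_n) : 3 < n ->
  @cadj (cycle_graph n) y1 y2 -> @cadj (cycle_graph n) y1 y3 ->
  @cadj (cycle_graph n) y2 y3 -> [|| y1 == y2, y1 == y3 | y2 == y3].
Proof.
(* Coordinates of linked vertices are equal or differ by one; the fourth case is the edge joining
   [0] and [n - 1]. *)
move=> n4; have near (y z : 'I_n) : @cadj (cycle_graph n) y z ->
    [\/ z = y :> nat, z = y.+1 :> nat, y = z.+1 :> nat |
        (z = 0 :> nat /\ y.+1 = n) \/ (y = 0 :> nat /\ z.+1 = n)].
  have S (w : 'I_n) : ordS w = (if w.+1 == n then 0 else w.+1) :> nat.
    rewrite /=; case: (w.+1 =P n) => [->|]; first by rewrite modnn.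
    by move=> wn; rewrite modn_small //; have := ltn_ord w; lia.
  rewrite cadj_cycleE => /or3P[] /eqP /(congr1 (@nat_of_ord n)); rewrite ?S.
  - by move=> ?; constructor 1.
  - by case: eqP => ? ?; [constructor 4; left|constructor 2].
  - by case: eqP => ? ?; [constructor 4; right|constructor 3].
move=> /near h12 /near h13 /near h23; rewrite -!val_eqE /=.
have := ltn_ord y1; have := ltn_ord y2; have := ltn_ord y3.
by case: h12 => ?; case: h13 => ?; case: h23 => ?; lia.
Qed.

Hypothesis n3 : 2 < n.

Lemma ordS_neq (y : 'I_n) : ordS y != y.
Proof.
rewrite -val_eqE /=; have := ltn_ord y; have [yn|ny] := eqVneq y.+1 n.
  by rewrite [X in X %% _]yn modnn; lia.
by move=> yn; rewrite modn_small; lia.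
Qed.

Lemma ordSS_neq (y : 'I_n) : ordS (ordS y) != y.
Proof.
rewrite -val_eqE /= -addn1 modnDml addn1; have := ltn_ord y => yn.
have [yE|ny] := leqP n y.+2; last by rewrite modn_small; lia.
have -> : y.+2 = (y.+2 - n) + n by lia.
by rewrite modnDr modn_small; lia.
Qed.

Lemma sum_cadj_cycle (F : 'I_n -> nat) (y : 'I_n) :
  \sum_z (if @cadj (cycle_graph n) y z then F z else 0) =
  F y + F (ordS y) + F (ord_pred y).
Proof.
have Sp : ordS (ord_pred y) = y by rewrite ord_predK.
rewrite -big_mkcond (bigD1 y) ?cadj_cycleE ?eqxx //=.
rewrite (bigD1 (ordS y)) ?cadj_cycleE ?eqxx ?ordS_neq ?orbT //=.
rewrite (bigD1 (ord_pred y)) /=; last first.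
  rewrite cadj_cycleE Sp eqxx !orbT /=; apply/andP; split.
    by have := ordS_neq (ord_pred y); rewrite Sp eq_sym.
  by have := ordSS_neq (ord_pred y); rewrite Sp eq_sym.
rewrite big1 ?addn0 ?addnA // => z; rewrite cadj_cycleE.
case: (z =P y) => //= _; rewrite andbT; case: (z =P ordS y) => //= _.
by rewrite andbT; case: (y =P ordS z) => //= ->; rewrite ordSK eqxx.
Qed.

End Cycle.

(** * Cuts of the strong product, layer by layer *)

Section Product.
Variables (G : sgraph) (n : nat).
Hypothesis n3 : 2 < n.
Let P := strong_product G (cycle_graph n).
Implicit Types (A B : {set P}) (p q : P) (y : 'I_n).

Definition layer A y : {set G} := [set x | (x, y) \in A].

Lemma layerC A y : layer (~: A) y = ~: layer A y.
Proof. by apply/setP => x; rewrite !inE. Qed.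

Lemma cadj_product p q :
  cadj p q = cadj p.1 q.1 && @cadj (cycle_graph n) p.2 q.2.
Proof.
case: p q => [x y] [x' y']; rewrite /cadj /= /strong_adj /= xpair_eqE.
have [->|_] := eqVneq x x'; have [->|_] := eqVneq y y' => //=;
  by rewrite ?adj_irr ?orbF ?andbT // orb_idr // => /andP[].
Qed.

Lemma sum_product (F : P -> nat) : \sum_p F p = \sum_x \sum_y F (x, y).
Proof. by rewrite pair_bigA /=; apply: eq_bigr => -[]. Qed.

Lemma card_layers A : #|A| = \sum_y #|layer A y|.
Proof.
rewrite -sum1_card big_mkcond sum_product exchange_big /=; apply: eq_bigr => y _.
by rewrite -sum1_card [RHS]big_mkcond; apply: eq_bigr => x _; rewrite inE.
Qed.

(** Closed neighbourhoods multiply, and those in the cycle have three elements. *)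
Lemma degree_product p : (degree p).+1 = 3 * (degree p.1).+1.
Proof.
rewrite -!cadj_degree sum_product big_distrr /=; apply: eq_bigr => x _.
transitivity (\sum_z (if @cadj (cycle_graph n) p.2 z
                      then (cadj p.1 x : nat) else 0)).
  apply: eq_bigr => z _; rewrite cadj_product /=.
  by case: (cadj p.1 x); case: cadj.
by rewrite sum_cadj_cycle //; case: (cadj p.1 x).
Qed.

Lemma links_layers A B : links A B =
  \sum_(y < n) links (layer A y) (layer B y) +
  (\sum_(y < n) links (layer A y) (layer B (ordS y)) +
   \sum_(y < n) links (layer A (ordS y)) (layer B y)).
Proof.
(* After this shift the term at [y] collects the links from layer [y] of [A] to the layers of [B]
   over [y], its successor and its predecessor. *)
rewrite [X in _ + (_ + X)](reindex_inj (@ord_pred_inj n)) -!big_split /=.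
rewrite linksE sum_product exchange_big /=; apply: eq_bigr => y _ /=.
transitivity (\sum_z (if @cadj (cycle_graph n) y z
                      then links (layer A y) (layer B z) else 0)).
  transitivity (\sum_x \sum_z \sum_x'
      (if ((x, y) \in A) && ((x', z) \in B)
       then cadj x x' && @cadj (cycle_graph n) y z : nat else 0)).
    apply: eq_bigr => x _; rewrite sum_product exchange_big /=.
    by apply: eq_bigr => z _; apply: eq_bigr => x' _; rewrite cadj_product.
  rewrite exchange_big /=; apply: eq_bigr => z _; rewrite linksE.
  case: ifP => yz; last first.
    by rewrite big1 // => x _; rewrite big1 // => x' _; rewrite andbF if_same.
  apply: eq_bigr => x _; apply: eq_bigr => x' _; rewrite !inE.
  by rewrite andbT.
by rewrite sum_cadj_cycle // ord_predK addnA.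
Qed.

Variable d : nat.
Hypothesis deg_d : forall x : G, d <= degree x.

Lemma degree_product_ge p : 3 * d + 2 <= degree p.
Proof. by have := degree_product p; have := deg_d p.1; lia. Qed.

(** Meant for small sets: it yields [9 * d] for three vertices and [12 * d - 4] for four. *)
Lemma links_product_ge A : 3 * d.+1 * #|A| <= links A (~: A) + #|A| * #|A|.
Proof.
have := linksT_ge degree_product_ge A; rewrite -(links_setC A A).
by have := links_le_card A A; lia.
Qed.

Hypothesis d2 : 1 < d.
Hypothesis cut_d : forall a : {set G}, a != set0 -> a != setT ->
  d <= links a (~: a).
Hypothesis card_G : 4 < #|G|.
Hypothesis n4 : 3 < n.

Section Cut.
Variable A : {set P}.
Local Notation up := (\sum_(y < n) links (layer A y) (~: layer A (ordS y))).
Local Notation down := (\sum_(y < n) links (layer A (ordS y)) (~: layer A y)).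
Local Notation inner := (\sum_(y < n) links (layer A y) (~: layer A y)).

Lemma links_cut : links A (~: A) = inner + (up + down).
Proof.
rewrite links_layers; congr (_ + (_ + _)); apply: eq_bigr => y _;
  by rewrite layerC.
Qed.

(** Going forward from [u] to [v], the drop is paid by [up]; going forward from [v] to [u], the rise
    is paid by [down]. *)
Lemma layer_variation (u v : 'I_n) :
  2 * links (layer A u) setT <= 2 * links (layer A v) setT + (up + down).
Proof.
have : links (layer A u) setT <= links (layer A v) setT + up.
  apply: (@cycle_descent n (fun y => links (layer A y) setT)
    (fun y => links (layer A y) (~: layer A (ordS y)))) => y.
  exact: linksT_step.
have : links (layer A u) setT <= links (layer A v) setT + down.
  apply: (@cycle_ascent n (fun y => links (layer A y) setT)
    (fun y => links (layer A (ordS y)) (~: layer A y))) => y.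
  exact: linksT_step.
by lia.
Qed.


(** The full layer has at least [5 * d.+1] links, and the variation counts them twice. *)
Lemma links_full_empty (u v : 'I_n) : layer A u = setT -> layer A v = set0 ->
  10 * d + 10 <= links A (~: A).
Proof.
move=> Au Av; have := layer_variation u v; rewrite Au Av links0l links_cut.
have := linksT_ge deg_d [set: G]; rewrite cardsT.
have := leq_mul card_G (leqnn d.+1).
by lia.
Qed.

Lemma links_card3 : #|A| = 3 -> 9 * d <= links A (~: A).
Proof. by move=> A3; have := links_product_ge A; rewrite A3; lia. Qed.

(** An unlinked pair in [A] gains 2 over the previous bound. Otherwise [A] is a clique, which cannot
    lie over a single vertex of [G]; so it meets two copies of adjacent vertices, one of which has
    degree above [d], and this adds 3 to the degree sum. *)
Lemma links_card3_strict :
  (forall x y : G, adj x y -> degree x = d -> degree y <> d) ->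
  #|A| = 3 -> 9 * d + 2 <= links A (~: A).
Proof.
move=> nodd A3; have LA := links_setC A A.
have D_A := linksT_ge degree_product_ge A; rewrite A3 in D_A.
have [/forall_inP AA|] := boolP [forall p in A, [forall q in A, cadj p q]]; last first.
  case/forall_inPn => p pA /forall_inPn[q qA npq].
  by have := links_nonadj pA qA npq; rewrite A3; lia.
have {}AA p q : p \in A -> q \in A -> cadj p q by move=> /AA/forall_inP; apply.
suff [r rA dr] : exists2 r, r \in A & d < degree r.1.
  have := links_le_card A A; rewrite A3.
  suff : 9 * d + 12 <= links A setT by lia.
  rewrite linksT (bigD1 r) //= degree_product.
  have -> : 9 * d + 12 = 3 * d.+2 + 2 * (3 * d).+3 by lia.
  apply: leq_add; first by rewrite leq_mul2l.
  have cA : #|A :\ r| = 2 by have := cardsD1 r A; rewrite rA A3 add1n => -[].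
  rewrite -[X in X * _.+3]cA -sum_nat_const big_mkcond [leqRHS]big_mkcond.
  rewrite leq_sum // => p _.
  rewrite !inE andbC; case: ifP => // _.
  by rewrite ltnS -addn2 degree_product_ge.
suff [p [q [pA qA pq]]] : exists p q, [/\ p \in A, q \in A & p.1 != q.1].
  have := AA _ _ pA qA; rewrite cadj_product {1}/cadj (negPf pq) /=.
  case/andP => apq _; have := nodd _ _ apq.
  have := deg_d p.1; rewrite leq_eqVlt => /orP[/eqP dp|dp _]; last by exists p.
  have := deg_d q.1; rewrite leq_eqVlt => /orP[/eqP dq|dq _]; last by exists q.
  by move=> /(_ (esym dp))/(_ (esym dq)).
have /card_gt2P[p [q [r [[pA qA rA] [pq qr rp]]]]] : 2 < #|A| by rewrite A3.
have [pq1|pq1] := eqVneq p.1 q.1; last by exists p, q.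
have [qr1|qr1] := eqVneq q.1 r.1; last by exists q, r.
have c s t : s \in A -> t \in A -> @cadj (cycle_graph n) s.2 t.2.
  by move=> sA tA; have := AA _ _ sA tA; rewrite cadj_product => /andP[].
have := cycle_triangle_free n4 (c _ _ pA qA) (c _ _ pA rA) (c _ _ qA rA).
case/or3P => /eqP e2.
- by case/eqP: pq; apply: (@injective_projections _ _ p q).
- by case/eqP: rp; apply: (@injective_projections _ _ r p); congruence.
- by case/eqP: qr; apply: (@injective_projections _ _ q r).
Qed.

Hypothesis no_full : forall y, layer A y != setT.

Lemma inner_ge (u v : 'I_n) : u != v ->
  links (layer A u) (~: layer A u) + links (layer A v) (~: layer A v) <= inner.
Proof.
move=> uv; rewrite (bigD1 u) //= (bigD1 v) /=; last by rewrite eq_sym.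
by rewrite addnA leq_addr.
Qed.

(** Comparison with the empty layer costs [2 * #|layer A u| * d.+1] between layers. Four vertices in
    the layer give [8 * d.+1 + d]. With exactly three, another layer [w] is occupied, and the inner
    edges number at least [(3 * d.+1 - 9) + d], for a total of [10 * d]. *)
Lemma links_big_layer (u v : 'I_n) : layer A v = set0 -> 3 <= #|layer A u| ->
  4 <= #|A| -> 9 * d + 2 <= links A (~: A).
Proof.
move=> Av Au A4; have := layer_variation u v; rewrite Av links0l links_cut.
have Dd := linksT_ge deg_d (layer A u).
have dcut w : layer A w != set0 -> d <= links (layer A w) (~: layer A w).
  by move=> w0; apply: cut_d.
have Au0 : layer A u != set0 by rewrite -card_gt0; lia.
have uv : u != v by apply: contraNneq Au0 => ->; apply/eqP.
have := inner_ge uv; have := dcut u Au0.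
move: Au; rewrite leq_eqVlt => /orP[/eqP/esym A3|A5]; last first.
  by have := leq_mul A5 (leqnn d.+1); lia.
have [w wu Aw0] : exists2 w, w != u & layer A w != set0.
  apply/exists_inP; apply: contraTT A4; rewrite negb_exists_in.
  move=> /forall_inP A0; rewrite card_layers (bigD1 u) //= A3 big1 // => w wu.
  by have /negPn/eqP-> := A0 w wu; rewrite cards0.
have := inner_ge wu; have := dcut w Aw0; have := links_setC (layer A u) (layer A u).
by have := links_le_card (layer A u) (layer A u); rewrite A3 in Dd *; lia.
Qed.

Local Notation occ y := (layer A y != set0).

(** Two occupied layers fall under [cross_ge]; next to an empty layer, all the links of an occupied
    one, at least [d.+1], are cut. *)
Lemma cross_layers_ge y :
  d * occ y + d * occ (ordS y) + (occ y && ~~ occ (ordS y)) +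
    (~~ occ y && occ (ordS y)) <=
  links (layer A y) (~: layer A (ordS y)) + links (layer A (ordS y)) (~: layer A y).
Proof.
have D0 (a : {set G}) : a != set0 -> d.+1 <= links a setT.
  rewrite -card_gt0 => a0; apply: leq_trans _ (linksT_ge deg_d a).
  exact: leq_pmull.
have [->|y0] := eqVneq (layer A y) set0; have [->|z0] := eqVneq (layer A (ordS y)) set0.
- by rewrite /= !muln0.
- by rewrite links0l setC0 /=; have := D0 _ z0; lia.
- by rewrite links0l setC0 /=; have := D0 _ y0; lia.
- have := cross_ge deg_d cut_d (ltnW d2) y0 z0 (no_full _) (no_full _).
  by rewrite /=; lia.
Qed.

(** Each occupied layer is charged [d] for its inner edges and [d] on either side; every passage
    between occupied and empty layers adds 1. *)
Lemma links_cut_occ :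
  3 * d * (\sum_(y < n) occ y) + \sum_(y < n) (occ y && ~~ occ (ordS y) : nat) +
    \sum_(y < n) (~~ occ y && occ (ordS y) : nat) <= links A (~: A).
Proof.
have hi : d * (\sum_(y < n) occ y) <= inner.
  rewrite big_distrr leq_sum // => y _ /=.
  by have [->|y0] := eqVneq (layer A y) set0; rewrite ?muln0 ?muln1 // cut_d.
have hS : \sum_(y < n) occ (ordS y) = \sum_(y < n) occ y.
  by rewrite [RHS](reindex_inj (@ordS_inj n)).
have : \sum_(y < n) (d * occ y + d * occ (ordS y) + (occ y && ~~ occ (ordS y)) +
    (~~ occ y && occ (ordS y))) <= up + down.
  by rewrite -big_split leq_sum // => y _; apply: cross_layers_ge.
rewrite !big_split -!big_distrr /= hS links_cut => hx.
apply: leq_trans (leq_add hi hx) => {hi hS hx}.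
by move: (\sum_(y < n) _) (\sum_(y < n) _) (\sum_(y < n) _) => *; lia.
Qed.

Lemma links_no_full : 4 <= #|A| -> 9 * d + 2 <= links A (~: A).
Proof.
move=> A4; have hocc := links_cut_occ.
have [v /eqP Av|noempty] := pickP (fun y => layer A y == set0); last first.
  (* With all [n >= 4] layers occupied the bound is at least [12 * d]. *)
  suff E : \sum_y occ y = n by rewrite E in hocc; have := leq_mul (leqnn d) n4; lia.
  rewrite -[RHS]card_ord -sum1_card; apply: eq_bigr => y _.
  by rewrite noempty.
have [u Au|small] := pickP (fun y => 3 <= #|layer A y|).
  exact: links_big_layer Av Au A4.
have [M2|M3] := leqP (\sum_y occ y) 2.
  (* At most two occupied layers, each with at most two vertices. *)
  have A4' : #|A| = 4.
    apply/eqP; rewrite eqn_leq A4 andbT card_layers.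
    apply: leq_trans (_ : 2 * \sum_y occ y <= 4); last by lia.
    rewrite big_distrr leq_sum // => y _ /=.
    rewrite -cards_eq0; have := small y; case: eqP => /=; lia.
  by have := links_product_ge A; rewrite A4'; lia.
have [u Au] : exists u, layer A u != set0.
  apply/existsP; apply: contraTT M3 => /existsPn A0.
  by rewrite big1 // => y _; rewrite (negPf (A0 y)).
(* Some layer is occupied and some is empty, so a tour of the cycle has a fall and a rise: these
   supply the 2 beyond [9 * d]. *)
have fall : 1 <= \sum_(y < n) (occ y && ~~ occ (ordS y) : nat).
  have := @cycle_descent n (fun y => occ y : nat) (fun y => occ y && ~~ occ (ordS y)) u v.
  rewrite Au Av eqxx add0n; apply => y.
  by case: (layer A y != set0); case: (_ != _).
have rise : 1 <= \sum_(y < n) (~~ occ y && occ (ordS y) : nat).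
  have := @cycle_ascent n (fun y => occ y : nat) (fun y => ~~ occ y && occ (ordS y)) u v.
  rewrite Au Av eqxx add0n; apply => y.
  by case: (layer A y != set0); case: (_ != _).
have := leq_add (leq_add (leq_mul (leqnn (3 * d)) M3) fall) rise.
by move=> /leq_trans/(_ hocc); lia.
Qed.

End Cut.

(** If some layer of [A] is full, either another is empty, or the complement of [A] has no full
    layer and the same cut. *)
Lemma links_cut_ge (b : bool) A :
  (~~ b -> forall x y : G, adj x y -> degree x = d -> degree y <> d) ->
  3 <= #|A| -> 3 <= #|~: A| ->
  (if b then 9 * d else 9 * d + 2) <= links A (~: A).
Proof.
move=> nodd A3 A3C.
have half (B : {set P}) : (forall y, layer B y != setT) -> 3 <= #|B| ->
    (if b then 9 * d else 9 * d + 2) <= links B (~: B).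
  move=> no_full; rewrite leq_eqVlt => /orP[/eqP/esym B3|B4]; last first.
    by have := links_no_full no_full B4; case: b {nodd}; lia.
  by case: b nodd => nodd; [apply: links_card3|apply: links_card3_strict => //; apply: nodd].
have [u /eqP Au|no_full] := pickP (fun y => layer A y == setT); last first.
  by apply: half => // y; rewrite no_full.
have [v /eqP Av|no_empty] := pickP (fun y => layer A y == set0).
  by have := links_full_empty Au Av; case: b {nodd half}; lia.
rewrite -links_setCC; apply: half => // y; rewrite layerC.
by apply: contraFneq (no_empty y) => AT; rewrite -[layer A y]setCK AT setCT.
Qed.

End Product.

(** * Edge cuts as boundaries of vertex sets, and connected triples *)

Lemma sum_set3 (T : finType) (F : T -> nat) (a b c : T) :
  a != b -> a != c -> b != c -> \sum_(x in [set a; b; c]) F x = F a + F b + F c.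
Proof.
move=> ab ac bc; rewrite setUC big_setU1 ?big_setU1 ?big_set1 ?inE //=.
  by rewrite addnC.
by rewrite negb_or !(eq_sym c) ac.
Qed.

Section BoundaryCut.
Variable G : sgraph.
Implicit Types (x y : G) (a : {set G}).

Lemma mem_boundary a x y : adj x y ->
  ([set x; y] \in boundary a) = ((x \in a) != (y \in a)).
Proof.
move=> xy; rewrite inE; have -> : [set x; y] \in edges G.
  by apply/edgesP; exists x, y.
apply/exists_inP/idP => /= [[u ua /exists_inP[v va /eqP e]]|].
  move: va; rewrite inE => va.
  have: u \in [set x; y] by rewrite e !inE eqxx.
  have: v \in [set x; y] by rewrite e !inE eqxx orbT.
  rewrite !inE => /orP[]/eqP vE /orP[]/eqP uE; move: ua va; rewrite vE uE;
    by case: (x \in a); case: (y \in a).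
case xa: (x \in a); case ya: (y \in a) => // _.
  by exists x => //; apply/exists_inP; exists y; rewrite ?inE ?ya.
by exists y => //; apply/exists_inP; exists x; rewrite ?inE ?xa // setUC.
Qed.

Lemma adj_del_boundary a x y :
  @adj (del_edges (boundary a)) x y = adj x y && ((x \in a) == (y \in a)).
Proof. by rewrite /=; case xy: (adj x y); rewrite // mem_boundary // negbK. Qed.

Lemma boundary_edge_cut a : a != set0 -> a != setT -> edge_cut (boundary a).
Proof.
case/set0Pn => x xa aT; apply/andP; split.
  by apply/subsetP => e; rewrite inE => /andP[].
have [y ya] : exists y, y \notin a.
  apply/existsP; apply: contraNT aT => /existsPn aT; rewrite -subTset.
  by apply/subsetP => y _; apply/negPn/aT.
apply/negP => /forallP/(_ x)/forallP/(_ y) xy.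
have cl : closed (@adj (del_edges (boundary a))) (mem a).
  by move=> u v; rewrite adj_del_boundary => /andP[_ /eqP].
have E : (x \in a) = (y \in a) := closed_connect cl xy.
by rewrite -E xa in ya.
Qed.

(** Take one component of the graph without [S]: its complement contains another component, and an
    edge leaving it must lie in [S]. *)
Lemma restricted3_cut_boundary (S : {set {set G}}) : restricted3_edge_cut S ->
  exists a : {set G}, [/\ 3 <= #|a|, 3 <= #|~: a| & boundary a \subset S].
Proof.
case/andP => /andP[_ /forallPn[x /forallPn[y nxy]]] /forall_inP comp3.
pose comp z : {set G} := [set t | connect (@adj (del_edges S)) z t].
have c3 z : 3 <= #|comp z| by apply: comp3; apply: imset_f.
have csym := sym_connect_sym (@adj_sym (del_edges S)).
exists (comp x); split=> //.
  apply: leq_trans (c3 y) (subset_leq_card _); apply/subsetP => z.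
  rewrite !inE => yz; apply: contra nxy => /connect_trans; apply.
  by rewrite csym.
apply/subsetP => e eb; have := eb; rewrite inE => /andP[/edgesP[u [v [uv euv]]] _].
move: eb; rewrite {e}euv mem_boundary // !inE; apply: contraNT => nS.
have c : connect (@adj (del_edges S)) u v by apply: connect1; rewrite /= uv.
by apply/eqP; apply: same_connect_r.
Qed.

Lemma adj_neq x y : adj x y -> x != y.
Proof. by apply: contraTneq => ->; rewrite adj_irr. Qed.

Section Star.
Variables p q r : G.
Hypotheses (pq : adj p q) (pr : adj p r) (qr : q != r).
Let X := [set p; q; r].
Let npq : p != q := adj_neq pq.
Let npr : p != r := adj_neq pr.

Lemma card_star : #|X| = 3.
Proof. by rewrite -sum1_card sum_set3. Qed.

(** Three self-links and both orders of the edges [pq] and [pr] make 7. *)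
Lemma links_star : links X X = 7 + 2 * cadj q r.
Proof.
rewrite /links !sum_set3 // (cadj_sym q p) (cadj_sym r p) (cadj_sym r q).
have cxx x : cadj x x by rewrite /cadj eqxx.
have [cpq cpr] : cadj p q /\ cadj p r by rewrite /cadj pq pr !orbT.
by rewrite !cxx cpq cpr; case: cadj.
Qed.

Lemma star_connected : connected (induced X).
Proof.
have pX : p \in X by rewrite !inE eqxx.
pose c : induced X := exist _ p pX.
have toc (u : induced X) : connect (@adj (induced X)) c u.
  case: u => u uX; have [up|up] := eqVneq u p.
    by have -> : exist _ u uX = c by apply: val_inj.
  apply: connect1; rewrite /=; move: (uX); rewrite !inE (negPf up) /=.
  by case/orP => /eqP ->.
apply/forallP => u; apply/forallP => v; apply: connect_trans (toc v).
by rewrite (sym_connect_sym (@adj_sym (induced X))).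
Qed.

(** A vertex outside [X] has at most three neighbours in [X], so it keeps at least two neighbours,
    which with itself make three vertices of its component. *)
Lemma star_restricted3_cut : (forall x, 5 <= degree x) ->
  restricted3_edge_cut (boundary X).
Proof.
move=> deg5; have csym := sym_connect_sym (@adj_sym (del_edges (boundary X))).
have degX x : 5 <= #|X| + #|[set y | adj x y] :\: X|.
  have := cardsID X [set y | adj x y]; have := deg5 x; rewrite /degree.
  by have := subset_leq_card (subsetIr [set y | adj x y] X); lia.
apply/andP; split.
  apply: boundary_edge_cut; first by rewrite -card_gt0 card_star.
  apply: contraTneq (degX p) => XT; rewrite card_star [X in _ :\: X]XT setDT cards0.
  by [].
suff comp3 (x : G) : 3 <= #|[set y : G | connect (@adj (del_edges (boundary X))) x y]|.
  by apply/forall_inP => C /imsetP[x _ ->]; apply: comp3.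
case xX: (x \in X).
  rewrite -card_star subset_leq_card //.
  have toc u : u \in X -> connect (@adj (del_edges (boundary X))) p u.
    move=> uX; have [->|up] := eqVneq u p; first exact: connect0.
    apply: connect1; rewrite adj_del_boundary uX !inE eqxx /= andbT.
    by move: uX; rewrite !inE (negPf up) /= => /orP[]/eqP->.
  apply/subsetP => u uX; rewrite inE; apply: connect_trans (toc u uX).
  by rewrite csym toc.
have xD : x \notin [set y | adj x y] :\: X by rewrite !inE adj_irr andbF.
apply: leq_trans (_ : #|x |: ([set y | adj x y] :\: X)| <= _).
  by rewrite cardsU1 xD add1n ltnS -(leq_add2l 3); have := degX x; rewrite card_star.
apply: subset_leq_card; apply/subsetP => y; rewrite [y \in [set _ | _]]inE.
case/setU1P => [->|]; first exact: connect0.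
rewrite in_setD inE => /andP[yX xy]; apply: connect1.
by rewrite adj_del_boundary xy xX (negPf yX).
Qed.

End Star.
End BoundaryCut.

(** * Minimum degree and edge-degree, and the final computation *)

Lemma min_degree_spec (G : sgraph) : 0 < #|G| ->
  (forall x : G, min_degree G <= degree x) /\
  exists x : G, degree x = min_degree G.
Proof.
case/card_gt0P => x _; rewrite /min_degree.
case E: minval => [k|] /=.
  by have [[y _ <-] kF] := minvalP E; split; [move=> z; apply: kF|exists y].
by move: E; rewrite /minval; case: pickP => // /(_ x).
Qed.

Lemma edge_degree_set2 (G : sgraph) (x y : G) : adj x y ->
  edge_degree [set x; y] = degree x + degree y - 2.
Proof.
by move=> /adj_neq xy; rewrite /edge_degree big_setU1 ?inE // big_set1.
Qed.

(** The value [2 * d - 2] bounds every edge-degree from below, with equality only when both ends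
    have degree [d]; [0 < d] keeps the subtraction from truncating. *)
Lemma min_edge_degreeP (G : sgraph) (d : nat) : 0 < d ->
  (forall x : G, d <= degree x) ->
  reflect (exists x y : G, [/\ adj x y, degree x = d & degree y = d])
          (min_edge_degree G == Some (2 * d - 2)).
Proof.
move=> d0 deg_d; apply: (iffP eqP).
  case/minvalP => -[e /edgesP[x [y [xy ->]]]].
  rewrite edge_degree_set2 // => exy _; exists x, y; have := deg_d x.
  by have := deg_d y; split=> //; lia.
case=> x [y [xy dx dy]]; apply: (minval_eq (i := [set x; y])).
- by apply/edgesP; exists x, y.
- by rewrite edge_degree_set2 // dx dy; lia.
move=> e /edgesP[u [v [uv ->]]].
by rewrite edge_degree_set2 //; have := deg_d u; have := deg_d v; lia.
Qed.

Theorem theorem3p1 (G : sgraph) (n : nat)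
    (hmax : maximally_edge_connected G) (hm : 5 <= #|G|)
    (hdelta : 2 <= min_degree G) (hn : 4 <= n) :
  [/\ lambda3 (strong_product G (cycle_graph n))
        = xi3 (strong_product G (cycle_graph n)),
      xi3 (strong_product G (cycle_graph n))
        = Some (if min_edge_degree G == Some (2 * min_degree G - 2)
                then 9 * min_degree G else 9 * min_degree G + 2)
    & maximally_3restricted_edge_connected (strong_product G (cycle_graph n))].
Proof.
have [deg_d [x0 dx0]] : _ /\ _ := min_degree_spec (leq_trans (isT : 0 < 5) hm).
have cut_d (a : {set G}) : a != set0 -> a != setT ->
    min_degree G <= links a (~: a).
  move=> a0 aT; rewrite -card_boundary; have [_] := minvalP hmax; apply.
  exact: boundary_edge_cut.
set P := strong_product _ _; set b := _ == _; move: hdelta deg_d dx0 cut_d @b.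
set d := min_degree G => d2 deg_d dx0 cut_d b.
have n3 : 2 < n by apply: leq_trans hn.
have bP : reflect _ b := min_edge_degreeP (ltnW d2) deg_d.
have nodd : ~~ b -> forall x y : G, adj x y -> degree x = d -> degree y <> d.
  by move=> /bP nb x y xy dx dy; apply: nb; exists x, y.
have lower (A : {set P}) : 3 <= #|A| -> 3 <= #|~: A| ->
    (if b then 9 * d else 9 * d + 2) <= #|boundary A|.
  rewrite card_boundary; exact: links_cut_ge.
(* This leaves at least three vertices outside any triple, as [lower] requires. *)
have cardP : 20 <= #|P|.
  by rewrite card_prod card_ord; apply: leq_trans (leq_mul hm hn).
have deg5 (p : P) : 5 <= degree p.
  by apply: leq_trans (degree_product_ge n3 deg_d p); lia.
have adjP (p q : P) : cadj p q -> p != q -> adj p q.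
  by rewrite /cadj => /orP[->|].
have [p [q [r [pq pr qr upper]]]] : exists p q r : P, [/\ adj p q, adj p r, q != r &
    #|boundary [set p; q; r]| <= if b then 9 * d else 9 * d + 2].
  have [y _] : exists y : 'I_n, true by exists (Ordinal (leq_trans (isT : 0 < 4) hn)).
  have cy z : @cadj (cycle_graph n) z (ordS z) by rewrite cadj_cycleE eqxx orbT.
  have cxx (H : sgraph) (x : H) : cadj x x by rewrite /cadj eqxx.
  (* The three closed neighbourhoods have [3 * d.+1] elements each; [links_star] counts the pairs
     inside. *)
  have star (p q r : P) : adj p q -> adj p r -> q != r -> degree p.1 = d ->
      degree q.1 = d -> degree r.1 = d ->
      #|boundary [set p; q; r]| = 9 * d + 2 - 2 * cadj q r.
    move=> pq pr qr dp dq dr; have := links_setC [set p; q; r] [set p; q; r].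
    rewrite -card_boundary links_star // linksT sum_set3 ?(adj_neq pq) ?(adj_neq pr) //.
    by rewrite !degree_product // dp dq dr; case: (cadj q r); lia.
  case bE: b.
    have /bP[u [v [uv du dv]]] := bE; have nuv := adj_neq uv.
    have cuv : cadj u v by rewrite /cadj uv orbT.
    (* Over an edge with both ends of degree [d], the triple is a triangle. *)
    pose p : P := (u, y); pose q : P := (u, ordS y); pose r : P := (v, y).
    have pq : adj p q.
      apply: adjP; first by rewrite cadj_product /= cxx cy.
      by rewrite xpair_eqE negb_and (eq_sym y) ordS_neq ?orbT.
    have pr : adj p r.
      apply: adjP; first by rewrite cadj_product /= cxx cuv.
      by rewrite xpair_eqE negb_and nuv.
    have qr : q != r by rewrite xpair_eqE negb_and nuv.
    exists p, q, r; split=> //; rewrite star // cadj_product /= cuv cadj_sym cy.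
    by lia.
  (* Otherwise three consecutive copies of a vertex of degree [d], centred at [p]. *)
  pose p : P := (x0, ordS y); pose q : P := (x0, y).
  pose r : P := (x0, ordS (ordS y)).
  have pq : adj p q.
    apply: adjP; first by rewrite cadj_product /= cxx cadj_sym cy.
    by rewrite xpair_eqE negb_and ordS_neq ?orbT.
  have pr : adj p r.
    apply: adjP; first by rewrite cadj_product /= cxx cy.
    by rewrite xpair_eqE negb_and (eq_sym (ordS y)) ordS_neq ?orbT.
  have qr : q != r.
    by rewrite xpair_eqE negb_and (eq_sym y) ordSS_neq ?orbT.
  by exists p, q, r; split=> //; rewrite star // leq_subr.
have xiE : xi3 P = Some (if b then 9 * d else 9 * d + 2).
  apply: (minval_eq (i := [set p; q; r])) => //.
    by rewrite card_star // star_connected.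
  move=> A /andP[/eqP A3 _]; apply: lower; rewrite ?A3 //.
  by have := cardsC A; rewrite A3; lia.
have lamE : lambda3 P = Some (if b then 9 * d else 9 * d + 2).
  apply: (minval_eq (i := boundary [set p; q; r])) => //.
    exact: star_restricted3_cut.
  move=> S /restricted3_cut_boundary[A [A3 A3C /subset_leq_card]].
  by apply: leq_trans; apply: lower.
by rewrite /maximally_3restricted_edge_connected lamE xiE; split.
Qed.
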